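(* Let $K^2$ be one of the three geometries $E^2$, $H^2$, $S^2$. Fix angles $\Phi_i,\Phi_j,\Phi_k\in[0,\pi)$, and consider radii $r_i,r_j,r_k$ for which the triangle in $K^2$ formed by the centers of three circles of radii $r_i,r_j,r_k$ intersecting at these angles exists. Let $\theta_n$ be the inner angle of this triangle at the center of the circle of radius $r_n$, regarded as a function of $(r_i,r_j,r_k)$. Then $$\frac{\partial\theta_i}{\partial r_j}\,s(r_j)=\frac{\partial\theta_j}{\partial r_i}\,s(r_i).$$
   Context: $E^2,H^2,S^2$ denote the Euclidean plane, the hyperbolic plane of curvature $-1$ and the sphere of curvature $1$. The function $s$ is $s(x)=x$ for $E^2$, $s(x)=\sinh x$ for $H^2$, $s(x)=\sin x$ for $S^2$. Let $v_i,v_j,v_k$ be the centers of the three circles and let $x_n$ be the length of the triangle edge opposite to $v_n$. The angles are exterior intersection angles: the circles centered at $v_j$ and $v_k$ meet in angle $\Phi_i$ (and cyclically), so angle $0$ corresponds to external tangency, and $x_i$ is determined by $x_i^2=r_j^2+r_k^2+2r_jr_k\cos\Phi_i$ in $E^2$; $\cosh x_i=\cosh r_j\cosh r_k+\sinh r_j\sinh r_k\cos\Phi_i$ in $H^2$; $\cos x_i=\cos r_j\cos r_k-\sin r_j\sin r_k\cos\Phi_i$ in $S^2$; and similarly for $x_j$ and $x_k$. Existence of the triangle means that $x_i,x_j,x_k$ are the edge lengths of a non-degenerate triangle in $K^2$ (in $S^2$ the radii lie in $(0,\pi)$; in $E^2,H^2$ they are positive). The partial derivatives are taken with $\Phi_i,\Phi_j,\Phi_k$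 fixed. *)

(* Defs.v *)
From Stdlib Require Import Reals.
From Coquelicot Require Import Coquelicot.

Open Scope R_scope.

Inductive geometry : Set := E2 | H2 | S2.

(** The three planes are realised in [R^3]: [E2] as the affine plane [z = 1],
    [H2] as the upper sheet of the hyperboloid [x^2 + y^2 - z^2 = -1], and [S2]
    as the unit sphere.  In all three models the geodesic lines are exactly the
    non-empty intersections with planes through the origin. *)
Record vec : Set := Vec { vx : R; vy : R; vz : R }.

Definition vadd (u v : vec) : vec := Vec (vx u + vx v) (vy u + vy v) (vz u + vz v).
Definition vscal (a : R) (u : vec) : vec := Vec (a * vx u) (a * vy u) (a * vz u).
Definition vsub (u v : vec) : vec := vadd u (vscal (-1) v).

(** The ambient symmetric bilinear form; restricted to the tangent planes of
    the model it is the Riemannian metric, positive definite in each case. *)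
Definition form (K : geometry) (u v : vec) : R :=
  match K with
  | E2 => vx u * vx v + vy u * vy v
  | H2 => vx u * vx v + vy u * vy v - vz u * vz v
  | S2 => vx u * vx v + vy u * vy v + vz u * vz v
  end.

Definition on_plane (K : geometry) (p : vec) : Prop :=
  match K with
  | E2 => vz p = 1
  | H2 => form H2 p p = -1 /\ 0 < vz p
  | S2 => form S2 p p = 1
  end.

Definition arcosh (y : R) : R := ln (y + sqrt (y ^ 2 - 1)).

Definition dist_in (K : geometry) (p q : vec) : R :=
  match K with
  | E2 => sqrt (form E2 (vsub q p) (vsub q p))
  | H2 => arcosh (- form H2 p q)
  | S2 => acos (form S2 p q)
  end.

Definition on_common_geodesic (p q r : vec) : Prop :=
  exists a b c : R, ~ (a = 0 /\ b = 0 /\ c = 0) /\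
    a * vx p + b * vy p + c * vz p = 0 /\
    a * vx q + b * vy q + c * vz q = 0 /\
    a * vx r + b * vy r + c * vz r = 0.

Definition nondegenerate_triangle (K : geometry) (p q r : vec) : Prop :=
  on_plane K p /\ on_plane K q /\ on_plane K r /\ ~ on_common_geodesic p q r.

(** A tangent vector at [p] pointing along the geodesic segment from [p] to
    [q]: the displacement for [E2], the orthogonal projection of [q] onto the
    tangent plane at [p] for [H2] and [S2]. *)
Definition direction (K : geometry) (p q : vec) : vec :=
  match K with
  | E2 => vsub q p
  | H2 => vadd q (vscal (form H2 p q) p)
  | S2 => vsub q (vscal (form S2 p q) p)
  end.

(** The inner angle at [p] of the triangle [p q r]. *)
Definition inner_angle (K : geometry) (p q r : vec) : R :=
  let u := direction K p q in
  let v := direction K p r in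
  acos (form K u v / (sqrt (form K u u) * sqrt (form K v v))).

Definition s (K : geometry) (x : R) : R :=
  match K with E2 => x | H2 => sinh x | S2 => sin x end.

Definition is_radius (K : geometry) (r : R) : Prop :=
  match K with
  | E2 | H2 => 0 < r
  | S2 => 0 < r < PI
  end.

(** [x] is the distance of the centers of two circles of radii [r] and [r']
    meeting at the exterior intersection angle [Phi]. *)
Definition center_distance (K : geometry) (Phi r r' x : R) : Prop :=
  match K with
  | E2 => x ^ 2 = r ^ 2 + r' ^ 2 + 2 * r * r' * cos Phi
  | H2 => cosh x = cosh r * cosh r' + sinh r * sinh r' * cos Phi
  | S2 => cos x = cos r * cos r' - sin r * sin r' * cos Phi
  end.

(** Each equation determines its edge length, since [dist_in] is nonnegative
    and, for [S2], at most [PI]. *)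
Definition circle_triangle (K : geometry) (Phi_i Phi_j Phi_k r_i r_j r_k : R)
    (v_i v_j v_k : vec) : Prop :=
  is_radius K r_i /\ is_radius K r_j /\ is_radius K r_k /\
  nondegenerate_triangle K v_i v_j v_k /\
  center_distance K Phi_i r_j r_k (dist_in K v_j v_k) /\
  center_distance K Phi_j r_k r_i (dist_in K v_k v_i) /\
  center_distance K Phi_k r_i r_j (dist_in K v_i v_j).

(* Main.v *)
Require Import Defs.
From Stdlib Require Import Reals Lra Psatz.
From Coquelicot Require Import Coquelicot.

(** The three geometries are treated at once by measuring a side by its squared
    chord [L = form K (q - p) (q - p)] in the ambient space instead of by its
    length [x]: [L] is [x^2], [2 (cosh x - 1)] or [2 (1 - cos x)], and every
    formula needed becomes one polynomial in squared chords with the curvature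
    [k], equal to 0, -1 or 1, as a parameter.  Writing [a] for the squared chord
    of a radius [r], one has [da/dr = 2 s], [ds/dr = 1 - k a / 2] and
    [s^2 = a - k a^2 / 4], and the law of cosines for two circles, of radii [r]
    and [r'] with squared chords [a] and [a'], reads
    [L = a + a' - k a a' / 2 + 2 s(r) s(r') cos Phi] ([center_chord2]).

    Differentiating this last formula and eliminating [cos Phi] by the formula
    itself gives [s(r_j) dL/dr_j] as a polynomial in squared chords alone
    ([is_derive_center_chord2]); this is where the factor [s(r_j)] of the theorem
    comes from.  The law of cosines for the inner angle, differentiated in
    [is_derive_side_angle], then turns [s(r_j) dtheta_i/dr_j] into an explicit
    expression [angle_rate] in the squared chords of the radii and of the sides,
    and that expression is visibly unchanged when [i] and [j] are exchanged.
    Since [theta_j] as a function of [r_i] is the same situation with [i] and [j]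
    exchanged, the theorem follows.

    The functions [theta] are only prescribed at radii for which a triangle
    exists, so differentiating them requires a triangle to exist for all nearby
    values of the radius being varied ([locally_circle_triangle]).  A triangle
    with prescribed squared chords exists as soon as finitely many strict
    polynomial inequalities hold ([triangle_with_chords]), and every non-degenerate triangle satisfies them
    ([circle_triangle_data]); the decisive one is positivity of [gram], which is
    four times the squared determinant of the vertices. *)

(** * Squared chords and the law of cosines *)

Definition curvature (K : geometry) : R :=
  match K with E2 => 0 | H2 => -1 | S2 => 1 end.

Definition chord2 (K : geometry) (p q : vec) : R :=
  form K (vsub q p) (vsub q p).

(** This is [s x ^ 2] when [L] is the squared chord of a side of length [x]. *)
Definition side_s2 (k L : R) : R := L - k * L ^ 2 / 4.

(** The inner product of the initial vectors, of lengths [s] of the respective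
    sides, of the sides with squared chords [b] and [c], when [a] is the squared
    chord of the opposite side; see [form_direction]. *)
Definition side_dot (k a b c : R) : R := (b + c - a) / 2 - k * b * c / 4.

(** For [k = 0] this is Heron's expression for sixteen times the squared area. *)
Definition gram (k a b c : R) : R :=
  2 * (a * b + b * c + c * a) - (a ^ 2 + b ^ 2 + c ^ 2) - k * a * b * c.

(** The angle opposite to the side with squared chord [a], by the law of
    cosines. *)
Definition side_angle (k a b c : R) : R :=
  acos (side_dot k a b c / (sqrt (side_s2 k b) * sqrt (side_s2 k c))).

Lemma gram_side_dot k a b c :
  gram k a b c = 4 * (side_s2 k b * side_s2 k c - side_dot k a b c ^ 2).
Proof. unfold gram, side_s2, side_dot; field. Qed.

Lemma gram_swap12 k a b c : gram k a b c = gram k b a c.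
Proof. unfold gram; ring. Qed.

Lemma gram_swap23 k a b c : gram k a b c = gram k a c b.
Proof. unfold gram; ring. Qed.

Lemma form_sym K p q : form K p q = form K q p.
Proof. destruct K; simpl; ring. Qed.

Lemma chord2_sym K p q : chord2 K p q = chord2 K q p.
Proof. unfold chord2, vsub, vadd, vscal; destruct K; simpl; ring. Qed.

Lemma chord2_form K p q :
  chord2 K p q = form K p p + form K q q - 2 * form K p q.
Proof. unfold chord2, vsub, vadd, vscal; destruct K; simpl; ring. Qed.

(** The directions at [p] are [q] and [r] corrected by multiples of [p], so their
    product expands into products of vertices, and [form K] is determined by
    squared chords because [form K p p] is the same for all points of the
    plane. *)
Lemma form_direction K p q r : on_plane K p -> on_plane K q -> on_plane K r ->
  form K (direction K p q) (direction K p r) =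
  side_dot (curvature K) (chord2 K q r) (chord2 K p q) (chord2 K p r).
Proof.
  intros Hp Hq Hr; unfold side_dot; rewrite !chord2_form.
  destruct K; cbn [curvature].
  - unfold direction, vsub, vadd, vscal; simpl; field.
  - destruct Hp as [Hp _], Hq as [Hq _], Hr as [Hr _].
    replace (form H2 (direction H2 p q) (direction H2 p r))
      with (form H2 q r + form H2 p q * form H2 p r * (2 + form H2 p p))
      by (unfold direction, vadd, vscal; simpl; ring).
    rewrite Hp, Hq, Hr; field.
  - unfold on_plane in *.
    replace (form S2 (direction S2 p q) (direction S2 p r))
      with (form S2 q r - form S2 p q * form S2 p r * (2 - form S2 p p))
      by (unfold direction, vsub, vadd, vscal; simpl; ring).
    rewrite Hp, Hq, Hr; field.
Qed.

Lemma side_dot_self k b : side_dot k 0 b b = side_s2 k b.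
Proof. unfold side_dot, side_s2; field. Qed.

Lemma chord2_refl K p : chord2 K p p = 0.
Proof. rewrite chord2_form; ring. Qed.

Lemma inner_angle_chord2 K p q r :
  on_plane K p -> on_plane K q -> on_plane K r ->
  inner_angle K p q r =
  side_angle (curvature K) (chord2 K q r) (chord2 K p q) (chord2 K p r).
Proof.
  intros Hp Hq Hr; unfold inner_angle, side_angle; cbv zeta.
  rewrite !form_direction by assumption.
  now rewrite !chord2_refl, !side_dot_self.
Qed.

(** * Inequalities satisfied by non-degenerate triangles *)

Definition det3 (p q r : vec) : R :=
  vx p * (vy q * vz r - vz q * vy r) - vy p * (vx q * vz r - vz q * vx r)
  + vz p * (vx q * vy r - vy q * vx r).

(** For [S2] and [H2] the right-hand side is, up to sign, a Gram determinant of
    the ambient form; for [E2] the determinant is twice the area because the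
    vertices have third coordinate 1. *)
Lemma gram_det3 K p q r : on_plane K p -> on_plane K q -> on_plane K r ->
  gram (curvature K) (chord2 K q r) (chord2 K p q) (chord2 K p r) =
  4 * det3 p q r ^ 2.
Proof.
  intros Hp Hq Hr; unfold gram; destruct K; cbn [curvature].
  - unfold on_plane in *; unfold det3; rewrite Hp, Hq, Hr.
    unfold chord2, vsub, vadd, vscal; simpl; ring.
  - destruct Hp as [Hp _], Hq as [Hq _], Hr as [Hr _].
    rewrite !chord2_form.
    replace (det3 p q r ^ 2) with
      (- (form H2 p p * (form H2 q q * form H2 r r - form H2 q r ^ 2)
       - form H2 p q * (form H2 p q * form H2 r r - form H2 q r * form H2 p r)
       + form H2 p r * (form H2 p q * form H2 q r - form H2 q q * form H2 p r)))
      by (unfold det3; simpl; ring).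
    rewrite Hp, Hq, Hr; ring.
  - unfold on_plane in *; rewrite !chord2_form.
    replace (det3 p q r ^ 2) with
      (form S2 p p * (form S2 q q * form S2 r r - form S2 q r ^ 2)
       - form S2 p q * (form S2 p q * form S2 r r - form S2 q r * form S2 p r)
       + form S2 p r * (form S2 p q * form S2 q r - form S2 q q * form S2 p r))
      by (unfold det3; simpl; ring).
    rewrite Hp, Hq, Hr; ring.
Qed.

(** A plane through the origin containing the three points is orthogonal to
    [p x q], or to [p x r] when the first product vanishes; if both vanish, all
    points are multiples of [p] and any vector orthogonal to [p] will do. *)
Lemma det3_eq0_common_geodesic p q r :
  ~ (vx p = 0 /\ vy p = 0 /\ vz p = 0) -> det3 p q r = 0 ->
  on_common_geodesic p q r.
Proof.
  unfold det3, on_common_geodesic.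
  destruct p as [x y z], q as [x1 y1 z1], r as [x2 y2 z2]; cbn [vx vy vz].
  intros Hp Hdet.
  set (n1 := y * z1 - z * y1); set (n2 := z * x1 - x * z1);
    set (n3 := x * y1 - y * x1).
  destruct (Req_dec (n1 ^ 2 + n2 ^ 2 + n3 ^ 2) 0) as [Hn | Hn].
  - assert (H1 : n1 = 0) by nra. assert (H2 : n2 = 0) by nra.
    assert (H3 : n3 = 0) by nra.
    set (m1 := y * z2 - z * y2); set (m2 := z * x2 - x * z2);
      set (m3 := x * y2 - y * x2).
    destruct (Req_dec (m1 ^ 2 + m2 ^ 2 + m3 ^ 2) 0) as [Hm | Hm].
    + assert (G1 : m1 = 0) by nra. assert (G2 : m2 = 0) by nra.
      assert (G3 : m3 = 0) by nra.
      unfold n1, n2, n3, m1, m2, m3 in *.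
      destruct (Req_dec x 0) as [Hx | Hx].
      * destruct (Req_dec y 0) as [Hy | Hy].
        -- exists 1, 0, 0; subst.
           assert (Hz : z <> 0) by tauto.
           repeat split; try lra.
           ++ apply (Rmult_eq_reg_l z); lra.
           ++ apply (Rmult_eq_reg_l z); lra.
        -- exists 0, z, (- y); repeat split; try lra. 
      * exists y, (- x), 0; repeat split; try lra.
    + (* [m] is normal to [p] and [r]; it is normal to [q] because the
         determinant vanishes. *)
      exists m1, m2, m3; repeat split.
      * intros (A & B & C); apply Hm; rewrite A, B, C; ring.
      * unfold m1, m2, m3; ring.
      * transitivity (- (x * (y1 * z2 - z1 * y2) - y * (x1 * z2 - z1 * x2)
                         + z * (x1 * y2 - y1 * x2))).
        -- unfold m1, m2, m3; ring.
        -- rewrite Hdet; ring.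
      * unfold m1, m2, m3; ring.
  - exists n1, n2, n3; repeat split.
    + intros (A & B & C); apply Hn; rewrite A, B, C; ring.
    + unfold n1, n2, n3; ring.
    + unfold n1, n2, n3; ring.
    + rewrite <- Hdet; unfold n1, n2, n3; ring.
Qed.

Lemma on_plane_neq0 K p : on_plane K p -> ~ (vx p = 0 /\ vy p = 0 /\ vz p = 0).
Proof.
  destruct K; simpl; intros Hp (A & B & C); rewrite ?A, ?B, ?C in Hp; lra.
Qed.

Lemma nondegenerate_gram_gt0 K p q r : nondegenerate_triangle K p q r ->
  0 < gram (curvature K) (chord2 K q r) (chord2 K p q) (chord2 K p r).
Proof.
  intros (Hp & Hq & Hr & Hg); rewrite gram_det3 by assumption.
  assert (det3 p q r <> 0)
    by (intros H; apply Hg, det3_eq0_common_geodesic; eauto using on_plane_neq0).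
  nra.
Qed.

(** The reversed Cauchy-Schwarz inequality for points of the upper sheet. *)
Lemma form_H2_le p q : on_plane H2 p -> on_plane H2 q -> 1 <= - form H2 p q.
Proof.
  destruct p as [a b z], q as [c d w]; simpl; intros [Hp Hz] [Hq Hw].
  assert (Hz2 : z * z = 1 + a * a + b * b) by lra.
  assert (Hw2 : w * w = 1 + c * c + d * d) by lra.
  assert (1 + a * c + b * d <= z * w); [ | lra].
  destruct (Rle_dec (1 + a * c + b * d) 0) as [Hn | Hn].
  - assert (0 < z * w) by (apply Rmult_lt_0_compat; assumption). lra.
  - apply Rsqr_incr_0_var; [ | apply Rmult_le_pos; lra]. unfold Rsqr.
    replace (z * w * (z * w)) with ((z * z) * (w * w)) by ring.
    rewrite Hz2, Hw2.
    enough (0 <= (a - c) ^ 2 + (b - d) ^ 2 + (a * d - b * c) ^ 2) by lra.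
    pose proof (pow2_ge_0 (a - c)); pose proof (pow2_ge_0 (b - d));
      pose proof (pow2_ge_0 (a * d - b * c)); lra.
Qed.

Lemma form_S2_bounds p q : on_plane S2 p -> on_plane S2 q ->
  -1 <= form S2 p q <= 1.
Proof.
  destruct p as [a b z], q as [c d w]; simpl; intros Hp Hq.
  pose proof (pow2_ge_0 (a - c)); pose proof (pow2_ge_0 (b - d));
    pose proof (pow2_ge_0 (z - w)); pose proof (pow2_ge_0 (a + c));
    pose proof (pow2_ge_0 (b + d)); pose proof (pow2_ge_0 (z + w)); lra.
Qed.

Lemma chord2_ge0 K p q : on_plane K p -> on_plane K q -> 0 <= chord2 K p q.
Proof.
  intros Hp Hq; destruct K.
  - apply Rplus_le_le_0_compat; apply Rle_0_sqr.
  - rewrite chord2_form; pose proof (form_H2_le p q Hp Hq).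
    destruct Hp as [Hp _], Hq as [Hq _]; rewrite Hp, Hq; lra.
  - rewrite chord2_form; pose proof (form_S2_bounds p q Hp Hq).
    unfold on_plane in *; rewrite Hp, Hq; lra.
Qed.

Lemma side_s2_chord2_ge0 K p q : on_plane K p -> on_plane K q ->
  0 <= side_s2 (curvature K) (chord2 K p q).
Proof.
  intros Hp Hq; pose proof (chord2_ge0 K p q Hp Hq).
  unfold side_s2; destruct K; cbn [curvature].
  - lra.
  - nra.
  - revert H; rewrite chord2_form; pose proof (form_S2_bounds p q Hp Hq).
    unfold on_plane in *; rewrite Hp, Hq; nra.
Qed.

Lemma cosh_arcosh y : 1 <= y -> cosh (arcosh y) = y.
Proof.
  intros Hy; unfold cosh, arcosh.
  assert (Hs : sqrt (y ^ 2 - 1) * sqrt (y ^ 2 - 1) = y ^ 2 - 1)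
    by (apply sqrt_sqrt; nra).
  pose proof (sqrt_pos (y ^ 2 - 1)).
  rewrite exp_Ropp, exp_ln by lra.
  apply (Rmult_eq_reg_r (2 * (y + sqrt (y ^ 2 - 1)))); [ | lra].
  field_simplify; [nra | lra].
Qed.

(** * Circles and the distances of their centers *)

Definition radius_chord2 (K : geometry) (r : R) : R :=
  match K with
  | E2 => r ^ 2
  | H2 => 2 * (cosh r - 1)
  | S2 => 2 * (1 - cos r)
  end.

Definition center_chord2 (K : geometry) (Phi r r' : R) : R :=
  radius_chord2 K r + radius_chord2 K r'
  - curvature K * radius_chord2 K r * radius_chord2 K r' / 2
  + 2 * s K r * s K r' * cos Phi.

Lemma center_chord2_sym K Phi r r' :
  center_chord2 K Phi r r' = center_chord2 K Phi r' r.
Proof. unfold center_chord2; field. Qed.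

(** The reason for working with chords: the three cosine laws become a single
    one.  The bounds on [form K p q] are what makes [arcosh] and [acos] genuine
    inverses of [cosh] and [cos] here. *)
Lemma center_distance_chord2 K Phi r r' p q : on_plane K p -> on_plane K q ->
  center_distance K Phi r r' (dist_in K p q) <->
  chord2 K p q = center_chord2 K Phi r r'.
Proof.
  intros Hp Hq; pose proof (chord2_ge0 K p q Hp Hq) as Hpos.
  unfold center_chord2.
  destruct K; cbn [center_distance dist_in radius_chord2 curvature s].
  - fold (chord2 E2 p q); rewrite pow2_sqrt by assumption.
    split; intros H; rewrite H; field.
  - rewrite cosh_arcosh by now apply form_H2_le.
    rewrite chord2_form. destruct Hp as [Hp _], Hq as [Hq _]; rewrite Hp, Hq.
    split; intros H; lra.
  - rewrite cos_acos by now apply form_S2_bounds.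
    rewrite chord2_form. unfold on_plane in Hp, Hq; rewrite Hp, Hq.
    split; intros H; lra.
Qed.

Lemma circle_triangle_chord2 K Phi_i Phi_j Phi_k r_i r_j r_k v_i v_j v_k :
  circle_triangle K Phi_i Phi_j Phi_k r_i r_j r_k v_i v_j v_k <->
  is_radius K r_i /\ is_radius K r_j /\ is_radius K r_k /\
  nondegenerate_triangle K v_i v_j v_k /\
  chord2 K v_j v_k = center_chord2 K Phi_i r_j r_k /\
  chord2 K v_i v_k = center_chord2 K Phi_j r_i r_k /\
  chord2 K v_i v_j = center_chord2 K Phi_k r_i r_j.
Proof.
  unfold circle_triangle.
  rewrite (chord2_sym K v_i v_k), (center_chord2_sym K Phi_j r_i r_k).
  split; intros (Hi & Hj & Hk & Hnd & Hjk & Hki & Hij);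
    refine (conj Hi (conj Hj (conj Hk (conj Hnd _))));
    destruct Hnd as (? & ? & ? & _);
    (split; [ | split]); apply center_distance_chord2; assumption.
Qed.

Lemma nondegenerate_triangle_swap K p q r :
  nondegenerate_triangle K p q r -> nondegenerate_triangle K q p r.
Proof.
  unfold nondegenerate_triangle, on_common_geodesic.
  intros (Hp & Hq & Hr & H); repeat split; try assumption.
  intros (a & b & c & H0 & H1 & H2 & H3); apply H; exists a, b, c; tauto.
Qed.

(** Exchanging two circles reverses the orientation of the triangle, which
    nothing in its definition sees. *)
Lemma circle_triangle_swap K Phi_i Phi_j Phi_k r_i r_j r_k v_i v_j v_k :
  circle_triangle K Phi_i Phi_j Phi_k r_i r_j r_k v_i v_j v_k ->
  circle_triangle K Phi_j Phi_i Phi_k r_j r_i r_k v_j v_i v_k.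
Proof.
  rewrite !circle_triangle_chord2.
  rewrite (chord2_sym K v_j v_i), (center_chord2_sym K Phi_k r_j r_i).
  intros (Hi & Hj & Hk & Hnd & Hjk & Hik & Hij).
  apply nondegenerate_triangle_swap in Hnd; tauto.
Qed.

Lemma inner_angle_swap K p q r : inner_angle K p q r = inner_angle K p r q.
Proof.
  unfold inner_angle; cbv zeta.
  rewrite (form_sym K (direction K p q) (direction K p r)).
  now rewrite (Rmult_comm (sqrt _)).
Qed.

(** * Derivatives of sides and angles *)

Lemma s_squared K r : s K r ^ 2 = side_s2 (curvature K) (radius_chord2 K r).
Proof.
  unfold side_s2; destruct K; cbn [s curvature radius_chord2].
  - field.
  - unfold sinh, cosh. assert (exp r * exp (- r) = 1)
      by (rewrite <- exp_plus, Rplus_opp_r; apply exp_0).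
    nra.
  - pose proof (sin2_cos2 r); unfold Rsqr in *; lra.
Qed.

Lemma is_derive_s K r :
  is_derive (s K) r (1 - curvature K * radius_chord2 K r / 2).
Proof.
  destruct K; cbn [curvature radius_chord2].
  - apply (is_derive_ext (fun x => x)); [reflexivity | ].
    evar_last; [apply is_derive_id | unfold one; simpl; field].
  - evar_last; [apply is_derive_Reals, derivable_pt_lim_sinh | field].
  - evar_last; [apply is_derive_Reals, derivable_pt_lim_sin | field].
Qed.

Lemma is_derive_radius_chord2 K r : is_derive (radius_chord2 K) r (2 * s K r).
Proof.
  destruct K; cbn [s]; unfold radius_chord2.
  - auto_derive; [exact I | ring].
  - apply (is_derive_ext (fun x => scal 2 (minus (cosh x) 1))); [reflexivity|].
    evar_last.
    { apply is_derive_scal, (is_derive_minus (V := R_NormedModule)).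
      apply is_derive_Reals, derivable_pt_lim_cosh. apply is_derive_const. }
    unfold minus, plus, opp, zero; simpl; ring.
  - auto_derive; [exact I | ring].
Qed.

(** With the product [2 s(r) s(r') cos Phi] expressed through the squared chord
    itself, multiplying by [s K r] clears all occurrences of [s] and of
    the angle from the derivative. *)
Lemma is_derive_center_chord2 K Phi r r' :
  exists d, is_derive (fun x => center_chord2 K Phi x r') r d /\
    d * s K r = center_chord2 K Phi r r' + radius_chord2 K r - radius_chord2 K r'
      - curvature K * center_chord2 K Phi r r' * radius_chord2 K r / 2.
Proof.
  pose proof (is_derive_s K r) as Hs.
  pose proof (is_derive_radius_chord2 K r) as Ha.
  unfold center_chord2; eexists; split.
  - auto_derive; [ | reflexivity].
    repeat split; eexists; eassumption.
  - change (Derive (fun x => radius_chord2 K x) r) with (Derive (radius_chord2 K) r).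
    change (Derive (fun x => s K x) r) with (Derive (s K) r).
    rewrite (is_derive_unique _ _ _ Hs), (is_derive_unique _ _ _ Ha).
    pose proof (s_squared K r) as H2; unfold side_s2 in H2.
    match goal with |- ?l = _ => transitivity
      (2 * s K r ^ 2 * (1 - curvature K * radius_chord2 K r' / 2)
       + (1 - curvature K * radius_chord2 K r / 2)
         * (2 * s K r * s K r' * cos Phi)) end.
    + field.
    + rewrite H2; field.
Qed.

Lemma is_derive_div_sqrt (M F : R -> R) (t x dM dF : R) :
  is_derive M x dM -> is_derive F x dF -> 0 < F x -> t <> 0 ->
  is_derive (fun y => M y / (t * sqrt (F y))) x
    ((F x * dM - M x * dF / 2) / (t * sqrt (F x) * F x)).
Proof.
  intros HM HF HF0 Ht.
  pose proof (sqrt_lt_R0 _ HF0) as Hu.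
  evar_last.
  - auto_derive; [ | reflexivity].
    repeat split; try (eexists; eassumption); try assumption.
    apply Rmult_integral_contrapositive; lra.
  - change (Derive (fun y => M y) x) with (Derive M x).
    change (Derive (fun y => F y) x) with (Derive F x).
    rewrite (is_derive_unique _ _ _ HM), (is_derive_unique _ _ _ HF).
    assert (HF2 : F x = sqrt (F x) * sqrt (F x)) by (rewrite sqrt_sqrt; lra).
    set (u := sqrt (F x)) in *. rewrite HF2; field; lra.
Qed.

(** The cosine of the angle is a quotient as in [is_derive_div_sqrt], and its sine
    is [sqrt gram / (2 t u)] for [t] and [u] the values of [s] on the adjacent
    sides, by [gram_side_dot]; hence [gram > 0] keeps the argument of [acos] away
    from the points 1 and -1, where [acos] is not differentiable. *)
Lemma is_derive_side_angle k (A C : R -> R) (b x dA dC : R) :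
  is_derive A x dA -> is_derive C x dC ->
  0 < side_s2 k b -> 0 < side_s2 k (C x) -> 0 < gram k (A x) b (C x) ->
  is_derive (fun y => side_angle k (A y) b (C y)) x
    (- (side_s2 k (C x) * (dC - dA - k * b * dC / 2)
        - side_dot k (A x) b (C x) * (1 - k * C x / 2) * dC)
     / (sqrt (gram k (A x) b (C x)) * side_s2 k (C x))).
Proof.
  intros HA HC Hb Hc Hg; unfold side_angle.
  set (w := fun y => side_dot k (A y) b (C y)
                     / (sqrt (side_s2 k b) * sqrt (side_s2 k (C y)))).
  set (g := gram k (A x) b (C x)) in *.
  set (m := side_dot k (A x) b (C x)).
  set (t := sqrt (side_s2 k b)). set (u := sqrt (side_s2 k (C x))).
  assert (Ht : t * t = side_s2 k b) by (apply sqrt_sqrt; lra).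
  assert (Hu : u * u = side_s2 k (C x)) by (apply sqrt_sqrt; lra).
  assert (Ht0 : 0 < t) by now apply sqrt_lt_R0.
  assert (Hu0 : 0 < u) by now apply sqrt_lt_R0.
  assert (Hg0 : 0 < sqrt g) by now apply sqrt_lt_R0.
  assert (Hw : w x = m / (t * u)) by reflexivity.
  assert (Hw2 : 1 - (w x) ^ 2 = (sqrt g / (2 * t * u)) ^ 2).
  { rewrite Hw.
    replace ((sqrt g / (2 * t * u)) ^ 2)
      with (sqrt g * sqrt g / (4 * (t * t) * (u * u))) by (field; lra).
    rewrite sqrt_sqrt by lra.
    replace ((m / (t * u)) ^ 2) with (m ^ 2 / ((t * t) * (u * u))) by (field; lra).
    unfold g; rewrite gram_side_dot; fold m; rewrite <- Ht, <- Hu; field; lra. }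
  assert (Hq : 0 < sqrt g / (2 * t * u))
    by (apply Rdiv_lt_0_compat; [ | apply Rmult_lt_0_compat]; lra).
  assert (Hwb : -1 < w x < 1).
  { assert (0 < 1 - w x ^ 2) by (rewrite Hw2; apply pow_lt; exact Hq). nra. }
  assert (HM : is_derive (fun y => side_dot k (A y) b (C y)) x
                 ((dC - dA) / 2 - k * b * dC / 4)).
  { unfold side_dot; auto_derive; [repeat split; eexists; eassumption | ].
    change (Derive (fun y => A y) x) with (Derive A x).
    change (Derive (fun y => C y) x) with (Derive C x).
    rewrite (is_derive_unique _ _ _ HA), (is_derive_unique _ _ _ HC); field. }
  assert (HF : is_derive (fun y => side_s2 k (C y)) x
                 ((1 - k * C x / 2) * dC)).
  { unfold side_s2; auto_derive; [repeat split; eexists; eassumption | ].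
    change (Derive (fun y => C y) x) with (Derive C x).
    rewrite (is_derive_unique _ _ _ HC); field. }
  assert (Ht1 : t <> 0) by lra.
  pose proof (is_derive_div_sqrt _ _ t x _ _ HM HF Hc Ht1) as Hdw.
  fold w in Hdw.
  evar_last.
  - apply (is_derive_comp acos w).
    + eapply is_derive_Reals, derive_pt_eq_1, (derive_pt_acos (w x) Hwb).
    + exact Hdw.
  - replace (1 - Rsqr (w x)) with (1 - w x ^ 2) by (unfold Rsqr; ring).
    rewrite Hw2, sqrt_pow2 by lra.
    unfold scal; simpl; unfold mult; simpl. fold m u.
    field; lra.
Qed.

(** * Existence of triangles is an open condition *)

(** In all three models [(0, 0, 1)] is a point whose tangent plane is horizontal.
    Starting there, one side is drawn along the first axis, and the law of cosines
    dictates the direction of the other; positivity of [gram] is what leaves room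
    for a non-zero sine of the angle between them. *)
Lemma triangle_with_chords K a b c :
  0 < b -> 0 < c -> 0 < side_s2 (curvature K) b -> 0 < side_s2 (curvature K) c ->
  0 < gram (curvature K) a b c ->
  exists p q r, nondegenerate_triangle K p q r /\
    chord2 K q r = a /\ chord2 K p q = b /\ chord2 K p r = c.
Proof.
  intros Hb Hc Hfb Hfc Hg.
  set (k := curvature K) in *.
  (* [t] is the horizontal length of the first side, [x] and [y] are the
     horizontal coordinates of the end of the second one. *)
  set (t := sqrt (side_s2 k b)).
  set (u := sqrt (gram k a b c)).
  assert (Ht : t * t = side_s2 k b) by (apply sqrt_sqrt; lra).
  assert (Hu : u * u = gram k a b c) by (apply sqrt_sqrt; lra).
  assert (Ht0 : 0 < t) by now apply sqrt_lt_R0.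
  assert (Hu0 : 0 < u) by now apply sqrt_lt_R0.
  set (x := side_dot k a b c / t).
  set (y := u / (2 * t)).
  assert (Hy0 : 0 < y) by (apply Rdiv_lt_0_compat; lra).
  assert (Hxt : x * t = side_dot k a b c) by (unfold x; field; lra).
  assert (Hxy : x * x + y * y = side_s2 k c).
  { rewrite gram_side_dot in Hu.
    replace (x * x + y * y)
      with ((side_dot k a b c ^ 2 + u * u / 4) / (t * t))
      by (unfold x, y; field; lra).
    rewrite Hu, Ht; field; lra. }
  exists (Vec 0 0 1), (Vec t 0 (1 - k * b / 2)), (Vec x y (1 - k * c / 2)).
  unfold side_s2, side_dot in *; subst k.
  unfold nondegenerate_triangle, chord2, vsub, vadd, vscal, on_common_geodesic.
  repeat split.
  - destruct K; simpl; try split; lra.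
  - destruct K; simpl in *; try split; nra.
  - destruct K; simpl in *; try split; nra.
  - cbn [vx vy vz]. intros (n1 & n2 & n3 & H0 & H1 & H2 & H3).
    assert (n3 = 0) by lra; subst n3.
    assert (n1 * t = 0) by lra. assert (n1 = 0) by nra; subst n1.
    assert (n2 * y = 0) by lra. assert (n2 = 0) by nra; subst n2.
    apply H0; auto.
  - destruct K; simpl in *; nra.
  - destruct K; simpl in *; nra.
  - destruct K; simpl in *; nra.
Qed.

(** Strict positivity of the squared sines of the two sides comes from that of
    [gram], which bounds four times their product from below. *)
Lemma circle_triangle_data K Phi_i Phi_j Phi_k r_i r_j r_k v_i v_j v_k :
  circle_triangle K Phi_i Phi_j Phi_k r_i r_j r_k v_i v_j v_k ->
  let k := curvature K in
  let L_i := center_chord2 K Phi_i r_j r_k in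
  let L_j := center_chord2 K Phi_j r_i r_k in
  let L_k := center_chord2 K Phi_k r_i r_j in
  0 < gram k L_i L_j L_k /\
  0 < L_j /\ 0 < side_s2 k L_j /\ 0 < L_k /\ 0 < side_s2 k L_k /\
  inner_angle K v_i v_j v_k = side_angle k L_i L_j L_k.
Proof.
  rewrite circle_triangle_chord2; cbv zeta.
  intros (_ & _ & _ & Hnd & <- & <- & <-).
  pose proof (nondegenerate_gram_gt0 _ _ _ _ Hnd) as Hg.
  rewrite gram_swap23 in Hg.
  destruct Hnd as (Hi & Hj & Hk & _).
  rewrite inner_angle_swap, inner_angle_chord2 by assumption.
  rewrite (chord2_sym K v_k v_j).
  pose proof (chord2_ge0 K v_i v_k Hi Hk).
  pose proof (chord2_ge0 K v_i v_j Hi Hj).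
  pose proof (side_s2_chord2_ge0 K v_i v_k Hi Hk).
  pose proof (side_s2_chord2_ge0 K v_i v_j Hi Hj).
  assert (Hprod : 0 < side_s2 (curvature K) (chord2 K v_i v_k)
                    * side_s2 (curvature K) (chord2 K v_i v_j)).
  { rewrite gram_side_dot in Hg.
    pose proof (pow2_ge_0 (side_dot (curvature K) (chord2 K v_j v_k)
                  (chord2 K v_i v_k) (chord2 K v_i v_j))); lra. }
  assert (pos_of_s2 : forall L, 0 <= L -> 0 < side_s2 (curvature K) L -> 0 < L).
  { intros L HL Hs; destruct HL as [ | <-]; [assumption | ].
    unfold side_s2 in Hs; lra. }
  assert (0 < side_s2 (curvature K) (chord2 K v_i v_k)) by nra.
  assert (0 < side_s2 (curvature K) (chord2 K v_i v_j)) by nra.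
  repeat split; auto.
Qed.

Lemma circle_triangle_exists K Phi_i Phi_j Phi_k r_i r_j r_k :
  is_radius K r_i -> is_radius K r_j -> is_radius K r_k ->
  let k := curvature K in
  let L_i := center_chord2 K Phi_i r_j r_k in
  let L_j := center_chord2 K Phi_j r_i r_k in
  let L_k := center_chord2 K Phi_k r_i r_j in
  0 < gram k L_i L_j L_k ->
  0 < L_j -> 0 < side_s2 k L_j -> 0 < L_k -> 0 < side_s2 k L_k ->
  exists v_i v_j v_k,
    circle_triangle K Phi_i Phi_j Phi_k r_i r_j r_k v_i v_j v_k.
Proof.
  cbv zeta; intros Hri Hrj Hrk Hg Hj Hsj Hk Hsk.
  rewrite gram_swap23 in Hg.
  destruct (triangle_with_chords K _ _ _ Hk Hj Hsk Hsj Hg)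
    as (p & q & r & Hnd & H1 & H2 & H3).
  exists p, q, r; apply circle_triangle_chord2; tauto.
Qed.

Lemma locally_gt0 (f : R -> R) x :
  ex_derive f x -> 0 < f x -> locally x (fun y => 0 < f y).
Proof.
  intros Hf Hx.
  apply (ex_derive_continuous f x Hf (fun z => 0 < z)).
  exact (open_gt 0 (f x) Hx).
Qed.

Lemma locally_is_radius K r : is_radius K r -> locally r (is_radius K).
Proof.
  destruct K; simpl; intros Hr.
  - exact (open_gt 0 r Hr).
  - exact (open_gt 0 r Hr).
  - exact (open_and _ _ (open_gt 0) (open_lt PI) r Hr).
Qed.

(** The inequalities of [circle_triangle_data] involve only differentiable functions
    of [r_j], so they persist nearby, and [circle_triangle_exists] applies. *)
Lemma locally_circle_triangle K Phi_i Phi_j Phi_k r_i r_j r_k v_i v_j v_k :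
  circle_triangle K Phi_i Phi_j Phi_k r_i r_j r_k v_i v_j v_k ->
  locally r_j (fun r => exists u_i u_j u_k,
    circle_triangle K Phi_i Phi_j Phi_k r_i r r_k u_i u_j u_k).
Proof.
  intros H; pose proof (circle_triangle_data _ _ _ _ _ _ _ _ _ _ H) as Hd.
  cbv zeta in Hd; destruct Hd as (Hg & Hj & Hsj & Hk & Hsk & _).
  destruct H as (Hri & Hrj & Hrk & _).
  destruct (is_derive_center_chord2 K Phi_i r_j r_k) as (di & Hdi & _).
  destruct (is_derive_center_chord2 K Phi_k r_j r_i) as (dk & Hdk & _).
  apply (is_derive_ext _ (fun r => center_chord2 K Phi_k r_i r)) in Hdk;
    [ | intros; apply center_chord2_sym].
  assert (Hsk' : locally r_j (fun r =>
    0 < side_s2 (curvature K) (center_chord2 K Phi_k r_i r))).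
  { apply (locally_gt0 (fun r => _)); [ | exact Hsk].
    unfold side_s2; auto_derive; repeat split; eexists; eassumption. }
  assert (Hg' : locally r_j (fun r =>
    0 < gram (curvature K) (center_chord2 K Phi_i r r_k)
          (center_chord2 K Phi_j r_i r_k) (center_chord2 K Phi_k r_i r))).
  { apply (locally_gt0 (fun r => _)); [ | exact Hg].
    unfold gram; auto_derive; repeat split; eexists; eassumption. }
  assert (Hk' : locally r_j (fun r => 0 < center_chord2 K Phi_k r_i r)).
  { apply (locally_gt0 (fun r => _)); [ | exact Hk]. eexists; eassumption. }
  generalize (filter_and _ _ (locally_is_radius K r_j Hrj)
    (filter_and _ _ Hg' (filter_and _ _ Hk' Hsk'))).
  apply filter_imp; intros r (Hr & G & Lk & Sk).
  now apply circle_triangle_exists.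
Qed.

(** * The variation of the inner angles *)

(** The value of [s(r_j) dtheta_i/dr_j], written so that the symmetry in [i] and
    [j] is apparent.  For [k = 1] the numerator equals, up to a constant factor,
    [c_j G_i + c_i G_j - G_k (c_i G_i + c_j G_j) - c_k (1 - G_k^2)], where
    [c_n = cos r_n] and [G_n = cos x_n]. *)
Definition angle_rate (k a_i a_j a_k L_i L_j L_k : R) : R :=
  - ((a_i - a_j) * (L_j - L_i)
     + L_k * (2 * a_k + L_k - (a_i + a_j + L_i + L_j)
              + k * (a_i * L_i + a_j * L_j - a_k * L_k) / 2))
  / (2 * sqrt (gram k L_i L_j L_k) * side_s2 k L_k).

Lemma angle_rate_swap k a_i a_j a_k L_i L_j L_k :
  angle_rate k a_i a_j a_k L_i L_j L_k = angle_rate k a_j a_i a_k L_j L_i L_k.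
Proof.
  unfold angle_rate; rewrite (gram_swap12 k L_i L_j L_k).
  f_equal; field.
Qed.

(** Near [r_j] the angle is [side_angle] evaluated at the squared chords, two of
    which, [L_i] and [L_k], vary with [r_j]. *)
Lemma inner_angle_derivative K Phi_i Phi_j Phi_k theta r_i r_j r_k :
  (forall r v_i v_j v_k,
     circle_triangle K Phi_i Phi_j Phi_k r_i r r_k v_i v_j v_k ->
     theta r = inner_angle K v_i v_j v_k) ->
  (exists v_i v_j v_k,
     circle_triangle K Phi_i Phi_j Phi_k r_i r_j r_k v_i v_j v_k) ->
  ex_derive theta r_j /\
  Derive theta r_j * s K r_j =
  angle_rate (curvature K)
    (radius_chord2 K r_i) (radius_chord2 K r_j) (radius_chord2 K r_k)
    (center_chord2 K Phi_i r_j r_k) (center_chord2 K Phi_j r_i r_k)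
    (center_chord2 K Phi_k r_i r_j).
Proof.
  intros Htheta (v_i & v_j & v_k & H).
  pose proof (circle_triangle_data _ _ _ _ _ _ _ _ _ _ H) as Hd.
  cbv zeta in Hd; destruct Hd as (Hg & _ & Hsj & _ & Hsk & _).
  destruct (is_derive_center_chord2 K Phi_i r_j r_k) as (di & Hdi & Edi).
  destruct (is_derive_center_chord2 K Phi_k r_j r_i) as (dk & Hdk & Edk).
  apply (is_derive_ext _ (fun r => center_chord2 K Phi_k r_i r)) in Hdk;
    [ | intros; apply center_chord2_sym].
  rewrite (center_chord2_sym K Phi_k r_j r_i) in Edk.
  pose proof (is_derive_side_angle _ _ _ _ _ _ _ Hdi Hdk Hsj Hsk Hg) as Hder.
  apply (is_derive_ext_loc _ theta) in Hder.
  - split; [eexists; exact Hder | ].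
    rewrite (is_derive_unique _ _ _ Hder); unfold angle_rate.
    set (k := curvature K) in *.
    set (L_i := center_chord2 K Phi_i r_j r_k) in *.
    set (L_j := center_chord2 K Phi_j r_i r_k) in *.
    set (L_k := center_chord2 K Phi_k r_i r_j) in *.
    assert (sqrt (gram k L_i L_j L_k) <> 0)
      by (apply Rgt_not_eq, sqrt_lt_R0, Hg).
    match goal with |- - ?N / _ * _ = _ =>
      transitivity (- (side_s2 k L_k * (dk * s K r_j - di * s K r_j
                                        - k * L_j * (dk * s K r_j) / 2)
                       - side_dot k L_i L_j L_k * (1 - k * L_k / 2)
                         * (dk * s K r_j))
                    / (sqrt (gram k L_i L_j L_k) * side_s2 k L_k)) end.
    + field; lra.
    + rewrite Edi, Edk.
      apply (Rmult_eq_reg_r (2 * sqrt (gram k L_i L_j L_k) * side_s2 k L_k)).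
      * field_simplify; try lra. unfold side_s2, side_dot; field.
      * repeat apply Rmult_integral_contrapositive_currified; lra.
  - generalize (locally_circle_triangle _ _ _ _ _ _ _ _ _ _ H).
    apply filter_imp; intros r (u_i & u_j & u_k & Hu).
    pose proof (circle_triangle_data _ _ _ _ _ _ _ _ _ _ Hu) as Hd.
    cbv zeta in Hd; destruct Hd as (_ & _ & _ & _ & _ & Ha).
    now rewrite (Htheta _ _ _ _ Hu), Ha.
Qed.

Theorem lemma2p3 (K : geometry) (Phi_i Phi_j Phi_k : R)
  (hPhi_i : 0 <= Phi_i < PI) (hPhi_j : 0 <= Phi_j < PI) (hPhi_k : 0 <= Phi_k < PI)
  (theta_i theta_j : R -> R -> R -> R)
  (htheta_i : forall (r_i r_j r_k : R) (v_i v_j v_k : vec),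
     circle_triangle K Phi_i Phi_j Phi_k r_i r_j r_k v_i v_j v_k ->
     theta_i r_i r_j r_k = inner_angle K v_i v_j v_k)
  (htheta_j : forall (r_i r_j r_k : R) (v_i v_j v_k : vec),
     circle_triangle K Phi_i Phi_j Phi_k r_i r_j r_k v_i v_j v_k ->
     theta_j r_i r_j r_k = inner_angle K v_j v_k v_i)
  (r_i r_j r_k : R)
  (hex : exists v_i v_j v_k : vec,
     circle_triangle K Phi_i Phi_j Phi_k r_i r_j r_k v_i v_j v_k) :
  ex_derive (fun r => theta_i r_i r r_k) r_j /\
  ex_derive (fun r => theta_j r r_j r_k) r_i /\
  Derive (fun r => theta_i r_i r r_k) r_j * s K r_j =
  Derive (fun r => theta_j r r_j r_k) r_i * s K r_i.
Proof.
  destruct (inner_angle_derivative K Phi_i Phi_j Phi_k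
              (fun r => theta_i r_i r r_k) r_i r_j r_k) as [Di Ei].
  - intros r v_i v_j v_k; apply htheta_i.
  - exact hex.
  - destruct (inner_angle_derivative K Phi_j Phi_i Phi_k
                (fun r => theta_j r r_j r_k) r_j r_i r_k) as [Dj Ej].
    + intros r v_j v_i v_k H.
      rewrite inner_angle_swap.
      exact (htheta_j _ _ _ _ _ _ (circle_triangle_swap _ _ _ _ _ _ _ _ _ _ H)).
    + destruct hex as (v_i & v_j & v_k & H).
      exists v_j, v_i, v_k; now apply circle_triangle_swap.
    + repeat split; [exact Di | exact Dj | ].
      rewrite Ei, Ej, angle_rate_swap.
      now rewrite (center_chord2_sym K Phi_k r_i r_j).
Qed.
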